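(* Let $f(u)=u\ln|u|$ be considered as a composite function on $\Omega$. Assume that $u,v\in L^\infty(\Omega)$ (complex valued) and denote $\Lambda_\infty=\max\{\|u\|_{L^\infty(\Omega)},\|v\|_{L^\infty(\Omega)}\}$. For any $\alpha\in(0,1)$ and $\epsilon\in(0,\delta_\alpha]$ with $\delta_\alpha=e^{\frac{\alpha}{\alpha-1}}$, the following bounds hold. (i) If $\Lambda_\infty>\epsilon$, then $$ \|f(u)-f(v)\|^2\le \mathcal{H}_\alpha^2(\epsilon)\,\|u-v\|_{L^{2\alpha}(\Omega)}^{2\alpha}+\Upsilon^2(\epsilon,\Lambda_\infty)\,\|u-v\|^2, $$ where $$ \mathcal{H}_\alpha(\epsilon)=(2\epsilon)^{1-\alpha}\big(|\ln\epsilon|+1\big),\qquad \Upsilon(\epsilon,\Lambda_\infty)=\max_{\epsilon\le y\le\Lambda_\infty}\big\{|\ln y|+1\big\}. $$ (ii) If $\Lambda_\infty\le\epsilon$, then $$ \|f(u)-f(v)\|\le\mathcal{H}_\alpha(\epsilon)\,\|u-v\|_{L^{2\alpha}(\Omega)}^{\alpha}. $$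
   Context: $\Omega\subset\mathbb{R}^d$ ($d=1,2,3$) is a bounded domain. $f(z)=z\ln|z|$ for $z\in\mathbb{C}\setminus\{0\}$ and $f(0)=0$. For $0<p<\infty$, $\|w\|_{L^p(\Omega)}=\big(\int_\Omega|w|^p\,dx\big)^{1/p}$ (also used for $p<1$, where it is only a quasi-norm); $\|\cdot\|$ denotes $\|\cdot\|_{L^2(\Omega)}$. *)

(* Defs.v *)
From HB Require Import structures.
From mathcomp Require Import all_boot all_order all_algebra.
From mathcomp Require Import complex.
From mathcomp Require Import all_classical all_reals all_analysis.
From mathcomp Require Import measurable_realfun.
Set Implicit Arguments.
Unset Strict Implicit.
Unset Printing Implicit Defensive.
Import Order.TTheory GRing.Theory Num.Theory.
Import numFieldNormedType.Exports.
Import ComplexField.Normc.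
Local Open Scope classical_set_scope.
Local Open Scope ring_scope.

Section LebesgueMeasure.
Variables (R : realType) (d : nat).

(* The half-open box ]I.1, I.2]; it is empty, with volume 0, as soon as
   I.2 0 i <= I.1 0 i for some i. *)
Definition box (I : 'rV[R]_d * 'rV[R]_d) : set 'rV[R]_d :=
  [set x | forall i, I.1 0 i < x 0 i <= I.2 0 i].

Definition box_volume (I : 'rV[R]_d * 'rV[R]_d) : R :=
  \prod_(i < d) Num.max 0 (I.2 0 i - I.1 0 i).

(* Covers are indexed by an arbitrary P : set nat, hence may be finite. *)
Definition lebesgue_outer (A : set 'rV[R]_d) : \bar R :=
  ereal_inf [set y | exists (P : set nat) (I : nat -> 'rV[R]_d * 'rV[R]_d),
    A `<=` \bigcup_(k in P) box (I k) /\
    y = (\esum_(k in P) (box_volume (I k))%:E)%E].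

Let box_volume_ge0 I : (0 <= (box_volume I)%:E)%E.
Proof. by rewrite lee_fin; apply: prodr_ge0 => i _; rewrite le_max lexx. Qed.

Let lebesgue_outer_ge0 A : (0 <= lebesgue_outer A)%E.
Proof. by apply: le_ereal_inf_tmp => _ [P [I [_ ->]]]; exact: esum_ge0. Qed.

Let lebesgue_outer0 : lebesgue_outer set0 = 0%E.
Proof.
apply/eqP; rewrite eq_le lebesgue_outer_ge0 andbT.
apply: ereal_inf_lbound; exists set0, (fun=> (0, 0)).
by rewrite esum_set0; split => // x.
Qed.

Let le_lebesgue_outer : {homo lebesgue_outer : A B / A `<=` B >-> (A <= B)%E}.
Proof.
move=> A B AB; apply: ereal_inf_le_tmp => y [P [I [BI ->]]].
by exists P, I; split => //; exact: subset_trans BI.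
Qed.

Let lebesgue_outer_sigma_subadditive : sigma_subadditive lebesgue_outer.
Proof.
move=> A; have [[i ioo]|] := pselect (exists i, lebesgue_outer (A i) = +oo%E).
  by rewrite (eseries_pinfty _ _ ioo) ?leey// => n _;
    rewrite -ltNye (lt_le_trans _ (lebesgue_outer_ge0 _)).
rewrite -forallNE => Aoo; apply/lee_addgt0Pr => e e0.
rewrite (le_trans _ (epsilon_trick _ _ (ltW e0)))//.
pose Q n (F : set nat * (nat -> 'rV[R]_d * 'rV[R]_d)) :=
  A n `<=` \bigcup_(k in F.1) box (F.2 k) /\
  (\esum_(k in F.1) (box_volume (F.2 k))%:E <=
     lebesgue_outer (A n) + (e / (2 ^ n.+1)%:R)%:E)%E.
have [G QG] : {G & forall n, Q n (G n)}.
  apply: (@choice _ _ Q) => n.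
  have An : lebesgue_outer (A n) \is a fin_num.
    by rewrite ge0_fin_numE// lt_neqAle leey andbT; apply/eqP/Aoo.
  have en : 0 < e / (2 ^ n.+1)%:R by rewrite divr_gt0// ltr0n expn_gt0.
  have [_ [P [I [AI ->]]] ltI] := lb_ereal_inf_adherent en An.
  by exists (P, I); split => //; exact: ltW.
have /card_esym/ppcard_eqP[f] := card_nat2.
pose J k := (G (f k).1).2 (f k).2.
pose D := [set k | (G (f k).1).1 (f k).2].
apply: (@le_trans _ _ (\esum_(k in D) (box_volume (J k))%:E)%E).
  apply: ereal_inf_lbound; exists D, J; split => // x [n _ /(QG n).1[k Gk xk]].
  by exists (f^-1%FUN (n, k)); rewrite /D /J/= invK ?inE.
rewrite -(@reindex_esum _ _ _ D (setT `*`` (fun n => (G n).1)) f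
    (fun k => (box_volume ((G k.1).2 k.2))%:E)); last first.
  split => [k Dk //||[n k] [_ Gk]].
    by move=> k l _ _; exact: (@injT _ _ f).
  by exists (f^-1%FUN (n, k)); rewrite /D/= ?invK ?inE.
rewrite -(@esum_esum _ _ _ setT (fun n => (G n).1)
    (fun n k => (box_volume ((G n).2 k))%:E))//.
rewrite nneseries_esumT; last first.
  by move=> n; rewrite adde_ge0// lee_fin divr_ge0// ltW.
by apply: le_esum => n _; exact: (QG n).2.
Qed.

HB.instance Definition _ := isOuterMeasure.Build R _ lebesgue_outer
  lebesgue_outer0 lebesgue_outer_ge0 le_lebesgue_outer
  lebesgue_outer_sigma_subadditive.

End LebesgueMeasure.

(* R^d with the sigma-algebra of Lebesgue measurable (i.e. Caratheodory
   measurable) sets. *)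
Definition Rd (R : realType) (d : nat) : Type :=
  caratheodory_type (@lebesgue_outer R d).

HB.instance Definition _ (R : realType) (d : nat) := Measurable.copy (Rd R d)
  (caratheodory_type (@lebesgue_outer R d : {outer_measure set _ -> \bar R})).

Definition lebesgue (R : realType) (d : nat) : set (Rd R d) -> \bar R :=
  @lebesgue_outer R d.

HB.instance Definition _ (R : realType) (d : nat) :=
  isMeasure.Build _ (Rd R d) R (@lebesgue R d)
    (@caratheodory_measure0 R _ (@lebesgue_outer R d))
    (@caratheodory_measure_ge0 R _ (@lebesgue_outer R d))
    (@caratheodory_measure_sigma_additive R _ (@lebesgue_outer R d)).

(* 'rV[R]_d carries the sup norm, whose topology and bounded sets are the
   Euclidean ones. *)
Definition bounded_domain (R : realType) (d : nat) (Omega : set 'rV[R]_d) :=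
  [/\ Omega !=set0, open Omega, connected Omega & bounded_set Omega].

(* f z = z ln|z|, with f 0 = 0; normc is the R-valued modulus,
   of which the norm `|z| : R[i] is the image in R[i]. *)
Definition flog (R : realType) (z : R[i]) : R[i] :=
  if z == 0 then 0 else z * (ln (normc z))%:C%C.

(* The library Lnorm of |w| extended by 0 outside Omega. *)
Definition LpNorm (R : realType) (d : nat) (Omega : set 'rV[R]_d) (p : \bar R)
    (w : 'rV[R]_d -> R[i]) : \bar R :=
  ('N[@lebesgue R d]_p [((fun x : Rd R d => (normc (w x))%:E) \_ Omega)])%E.

Definition Linfty (R : realType) (d : nat) (Omega : set 'rV[R]_d)
    (w : 'rV[R]_d -> R[i]) : Prop :=
  [/\ measurable_fun (Omega : set (Rd R d)) (fun x : Rd R d => complex.Re (w x)),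
      measurable_fun (Omega : set (Rd R d)) (fun x : Rd R d => complex.Im (w x)) &
      (LpNorm Omega +oo w < +oo)%E].

(* fine is harmless here: both norms are finite for u, v in L^oo. *)
Definition Lambda_infty (R : realType) (d : nat) (Omega : set 'rV[R]_d)
    (u v : 'rV[R]_d -> R[i]) : R :=
  fine (Order.max (LpNorm Omega +oo u) (LpNorm Omega +oo v)).

Definition Halpha (R : realType) (alpha epsilon : R) : R :=
  (2 * epsilon) `^ (1 - alpha) * (`|ln epsilon| + 1).

(* For 0 < epsilon <= Lambda the sup is attained, i.e. it is a maximum. *)
Definition Upsilon (R : realType) (epsilon Lambda : R) : R :=
  sup [set `|ln y| + 1 | y in `[epsilon, Lambda]].

Definition delta_alpha (R : realType) (alpha : R) : R :=
  expR (alpha / (alpha - 1)).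

(* Main.v *)
Require Import Defs.
From mathcomp Require Import all_boot all_order all_algebra.
From mathcomp Require Import complex.
From mathcomp Require Import all_classical all_reals all_analysis.
From mathcomp Require Import measurable_realfun.
From mathcomp Require Import ring lra.
Import Order.TTheory GRing.Theory Num.Theory.
Import numFieldNormedType.Exports.
Local Open Scope classical_set_scope.
Local Open Scope ring_scope.
Import ComplexField.Normc.
Set Implicit Arguments.
Unset Strict Implicit.
Unset Printing Implicit Defensive.

(** The estimate is pointwise.  When |w| <= |z|, write
      f(z) - f(w) = (z - w) ln|z| + w (ln|z| - ln|w|)
    and use |w| (ln|z| - ln|w|) <= |z| - |w| (that is, ln t <= t - 1) to get
      |f(z) - f(w)| <= |z - w| (|ln|z|| + 1)                  ([normc_flogB]);
    only the larger modulus enters the logarithm.  There are two regimes.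

    If |z| <= epsilon, split |z - w| = |z - w|^(1-alpha) |z - w|^alpha and
    bound the first factor by (2|z|)^(1-alpha).  The threshold delta_alpha is
    exactly the point up to which y^(1-alpha) (|ln y| + 1) increases
    ([powR_ln_homo]), so |z| may be replaced by epsilon, which gives the
    Hoelder bound with constant H_alpha(epsilon).  If epsilon <= |z| <= Lambda,
    then |ln|z|| + 1 <= Upsilon(epsilon, Lambda), a Lipschitz bound.  In either
    regime |f(z) - f(w)|^2 is at most the sum of the two squared bounds
    ([normc_flogB_sq]), and below epsilon the first one alone is enough
    ([normc_flogB_small]).

    Both inequalities are then integrated over Omega, where |u| and |v| are
    almost everywhere at most Lambda ([ae_normc_le_Lambda]).  Additivity and
    monotonicity of the integral require a measurable domain, so the first part
    shows that open sets are Caratheodory measurable for the outer measure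
    generated by half-open boxes ([open_measurable_Rd]). *)

(** * Open sets are Lebesgue measurable *)

(** The side of a box cut by a hyperplane at height [c], when the interval from
    [a] to [b] may be empty and [c] may lie outside it. *)
Lemma max_sub_split (R : realDomainType) (a b c : R) :
  Num.max 0 (b - a) =
  Num.max 0 (Num.min b c - a) + Num.max 0 (b - Num.max a c).
Proof.
case: (leP b c) => bc; case: (leP a c) => ac.
- by rewrite (max_l (_ : b - c <= 0)) ?subr_le0// addr0.
- rewrite !(max_l (_ : b - a <= 0)) ?addr0// subr_le0; lra.
- have ab : a <= b by lra.
  by rewrite !max_r ?subr_ge0//; lra.
- by rewrite (max_l (_ : c - a <= 0)) ?add0r// subr_le0 ltW.
Qed.

Section OpenMeasurable.
Variables (R : realType) (d : nat).
Implicit Types (I : 'rV[R]_d * 'rV[R]_d) (i : 'I_d) (c : R).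

Definition box_below i c I : 'rV[R]_d * 'rV[R]_d :=
  (I.1, \row_j (if j == i then Num.min (I.2 0 j) c else I.2 0 j)).

Definition box_above i c I : 'rV[R]_d * 'rV[R]_d :=
  (\row_j (if j == i then Num.max (I.1 0 j) c else I.1 0 j), I.2).

Lemma box_volume_split i c I :
  box_volume I = box_volume (box_below i c I) + box_volume (box_above i c I).
Proof.
rewrite /box_volume (bigD1 i)//= [X in _ = X + _](bigD1 i)//=.
rewrite [X in _ = _ + X](bigD1 i)//= !mxE eqxx.
rewrite [X in _ = _ * X + _](eq_bigr (fun j => Num.max 0 (I.2 0 j - I.1 0 j))).
  rewrite [X in _ = _ + _ * X](eq_bigr (fun j => Num.max 0 (I.2 0 j - I.1 0 j))).
    by rewrite -mulrDl; congr (_ * _); exact: max_sub_split.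
  by move=> j /negbTE ji; rewrite mxE ji.
by move=> j /negbTE ji; rewrite mxE ji.
Qed.

Lemma box_volume_ge0 I : 0 <= box_volume I.
Proof. by apply: prodr_ge0 => i _; rewrite le_max lexx. Qed.

(** A hyperplane cuts every box of a cover into two boxes of the same total
    volume, so it turns a cover of [X] into covers of its two parts at no cost. *)
Lemma measurable_halfspace i c :
  measurable ([set x : 'rV[R]_d | x 0 i <= c] : set (Rd R d)).
Proof.
apply: le_caratheodory_measurable => X /=.
apply: le_ereal_inf_tmp => _ [P [I [XI ->]]].
rewrite (eq_esum (b := fun k => ((box_volume (box_below i c (I k)))%:E +
    (box_volume (box_above i c (I k)))%:E)%E)); last first.
  by move=> k _; rewrite -EFinD -box_volume_split.
rewrite esumD; [|by move=> *; rewrite lee_fin box_volume_ge0..].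
apply: leeD; apply: ereal_inf_lbound; exists P.
- exists (box_below i c \o I); split => // x [/XI[k Pk Ix] xc]; exists k => // j.
  have /andP[h1 h2] := Ix j; rewrite h1 mxE/=; case: eqP => // ji.
  by rewrite le_min h2 ji.
- exists (box_above i c \o I); split => // x [/XI[k Pk Ix] xc]; exists k => // j.
  have /andP[h1 h2] := Ix j; rewrite h2 andbT mxE/=; case: eqP => // ji.
  by rewrite gt_max h1 ji ltNge; apply/negP.
Qed.

Lemma measurable_box I : measurable (box I : set (Rd R d)).
Proof.
have -> : box I = \bigcap_(i in [set: 'I_d])
    ([set x | x 0 i <= I.2 0 i] `\` [set x | x 0 i <= I.1 0 i]).
  apply/seteqP; split => [x Ix i _|x Ix i].
    by have /andP[h1 h2] := Ix i; split => //=; apply/negP; rewrite -ltNge.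
  by have [h1 /negP h2] := Ix i Logic.I; rewrite ltNge h2.
apply: fin_bigcap_measurable => // i _.
by apply: measurableD; exact: measurable_halfspace.
Qed.

(** An open set is the union of the half-open boxes with rational corners that
    it contains, and there are only countably many of them. *)
Lemma open_measurable_Rd (A : set 'rV[R]_d) :
  open A -> measurable (A : set (Rd R d)).
Proof.
move=> oA.
pose B (q : 'rV[rat]_d * 'rV[rat]_d) : set (Rd R d) :=
  let I := (map_mx (@ratr R) q.1, map_mx (@ratr R) q.2) in
  if `[< box I `<=` A >] then box I else set0.
have -> : A = \bigcup_q B q.
  apply/seteqP; split => [x Ax|x [q _]]; last first.
    by rewrite /B; case: asboolP => // h; exact: h.
  have /nbhs_ballP[e/= e0 xeA] : nbhs x A by apply: open_nbhs_nbhs; split.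
  (* Rational corners at distance less than e from x in each coordinate: the
     resulting box lies in the sup-norm ball of radius e. *)
  have lo i : {q : rat | x 0 i - e < ratr q < x 0 i}.
    by apply: cid; have [q] := @rat_in_itvoo R (x 0 i - e) (x 0 i) ltac:(lra);
    rewrite in_itv/=; exists q.
  have hi i : {q : rat | x 0 i < ratr q < x 0 i + e}.
    by apply: cid; have [q] := @rat_in_itvoo R (x 0 i) (x 0 i + e) ltac:(lra);
    rewrite in_itv/=; exists q.
  exists (\row_i projT1 (lo i), \row_i projT1 (hi i)) => //.
  rewrite /B; case: asboolP => [_ i|[]].
    rewrite !mxE; case: (lo i) (hi i) => /= p /andP[_ ->] [q /= /andP[h _]].
    exact: ltW.
  move=> y Iy; apply: xeA; split => // r i; rewrite (ord1 r) /ball/=.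
  have := Iy i; rewrite !mxE; case: (lo i) (hi i) => /= p /andP[h1 h2].
  move=> [q /= /andP[h3 h4]] /andP[h5 h6].
  by rewrite ltr_norml; lra.
apply: countable_bigcupT_measurable => [|q]; first exact: countableP.
by rewrite /B; case: asboolP => _; [exact: measurable_box|exact: measurable0].
Qed.

End OpenMeasurable.

(** * Pointwise estimates *)

Section Pointwise.
Variable R : realType.
Implicit Types (z w : R[i]) (x y r e a : R).

Lemma normc_ge0 z : 0 <= normc z.
Proof. by case: z => x y; exact: sqrtr_ge0. Qed.

Lemma normc_real x : normc x%:C%C = `|x|.
Proof. by rewrite /normc/= expr0n/= addr0 sqrtr_sqr. Qed.

Lemma normc_triangle z w : normc (z + w) <= normc z + normc w.
Proof. exact: le_normcD. Qed.

Lemma normcBC z w : normc (z - w) = normc (w - z).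
Proof. by rewrite -(normcN (w - z)) opprB. Qed.

Lemma normcB_ge z w : normc z - normc w <= normc (z - w).
Proof. by rewrite lerBlDr -{1}(subrK w z) normc_triangle. Qed.

Lemma ln_leB1 x : 0 < x -> ln x <= x - 1.
Proof.
by move=> x0; have := @le_ln1Dx R (x - 1); rewrite [1 + _]addrC subrK; apply; lra.
Qed.

(** The case distinction at 0 is absorbed by the product. *)
Lemma flogE z : flog z = z * (ln (normc z))%:C%C.
Proof. by rewrite /flog; case: eqP => // ->; rewrite mul0r. Qed.

(** Estimating [w * (ln (normc z) - ln (normc w))] by [normc z - normc w] removes
    the logarithm of the smaller modulus, which is not bounded near 0. *)
Lemma normc_flogB z w : normc w <= normc z ->
  normc (flog z - flog w) <= normc (z - w) * (`|ln (normc z)| + 1).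
Proof.
move=> wz.
have -> : flog z - flog w = (z - w) * (ln (normc z))%:C%C +
    w * (ln (normc z) - ln (normc w))%:C%C.
  rewrite !flogE rmorphB/=; ring.
apply: le_trans (normc_triangle _ _) _.
rewrite !normcM !normc_real mulrDr mulr1 lerD2l.
apply: le_trans (normcB_ge _ _).
have := normc_ge0 w; rewrite le_eqVlt => /predU1P[<-|w0].
  by rewrite mul0r subr0 normc_ge0.
have z0 : 0 < normc z by exact: lt_le_trans wz.
rewrite -ln_div ?posrE// ger0_norm; last by rewrite ln_ge0// ler_pdivlMr// mul1r.
rewrite -ler_pdivlMl// (le_trans (ln_leB1 _)) ?divr_gt0//.
by rewrite mulrBr mulVf ?gt_eqF// [_ / _]mulrC.
Qed.

(** With t = ln e - ln y >= 0 and L = 1 - ln e, the claim reads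
    L + t <= L exp((1 - a) t).  It follows from exp s >= 1 + s as soon as
    L (1 - a) >= 1, which is precisely ln e <= a / (a - 1). *)
Lemma powR_ln_homo a y e : 0 < a < 1 -> 0 < y -> y <= e -> e <= delta_alpha a ->
  y `^ (1 - a) * (`|ln y| + 1) <= e `^ (1 - a) * (`|ln e| + 1).
Proof.
move=> /andP[a0 a1] y0 ye ed; have e0 : 0 < e by exact: lt_le_trans ye.
have led : ln e <= a / (a - 1) by rewrite -[leRHS]expRK ler_ln ?posrE ?expR_gt0.
have lye : ln y <= ln e by rewrite ler_ln ?posrE.
have a1V : a / (a - 1) < 0 by rewrite pmulr_rlt0// invr_lt0; lra.
have key : 1 <= (1 - a) * (1 - ln e).
  have e1 : 1 = (1 - a) * (1 - a / (a - 1)) by field; lra.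
  by rewrite [leLHS]e1 ler_pM2l; lra.
rewrite !ler0_norm; [|lra..].
rewrite /powR !gt_eqF//.
have -> : (1 - a) * ln e = (1 - a) * ln y + (1 - a) * (ln e - ln y) by ring.
rewrite expRD -mulrA ler_pM2l ?expR_gt0//.
have := expR_ge1Dx ((1 - a) * (ln e - ln y)); set E := expR _ => hE.
have : (1 + (1 - a) * (ln e - ln y)) * (1 - ln e) <= E * (1 - ln e).
  by rewrite ler_pM2r; lra.
have : 0 <= (ln e - ln y) * ((1 - a) * (1 - ln e) - 1) by rewrite mulr_ge0; lra.
rewrite [- ln e + 1]addrC.
nra.
Qed.

Lemma Halpha_ge0 a e : 0 <= Halpha a e.
Proof. by rewrite mulr_ge0 ?powR_ge0// addr_ge0. Qed.

Lemma normc_flogB_small a e z w : 0 < a < 1 -> e <= delta_alpha a ->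
  normc z <= e -> normc w <= e ->
  normc (flog z - flog w) <= Halpha a e * normc (z - w) `^ a.
Proof.
move=> a01 ed; wlog wz : z w / normc w <= normc z.
  move=> H ze we; have [|/ltW] := leP (normc w) (normc z); first by move/H; exact.
  by move=> /H; rewrite normcBC (normcBC z w); exact.
move=> ze we; apply: le_trans (normc_flogB wz) _.
have := normc_ge0 z; rewrite le_eqVlt => /predU1P[z0|z0].
  have w0 : normc w = 0 by apply/eqP; rewrite eq_le normc_ge0 andbT z0.
  rewrite (eq0_normc (esym z0)) (eq0_normc w0) subrr normc0 mul0r.
  by rewrite mulr_ge0 ?Halpha_ge0 ?powR_ge0.
have zw : normc (z - w) <= 2 * normc z.
  by have := normc_triangle z (- w); rewrite normcN; lra.
have e0 : 0 < e by exact: lt_le_trans ze.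
case/andP: (a01) => a0 a1.
have zwE : normc (z - w) = normc (z - w) `^ (1 - a) * normc (z - w) `^ a.
  rewrite -powRD ?subrK ?powRr1 ?normc_ge0//.
  by apply/implyP => /eqP; lra.
rewrite [X in X * _ <= _]zwE mulrAC ler_wpM2r ?powR_ge0//.
apply: (@le_trans _ _ ((2 * normc z) `^ (1 - a) * (`|ln (normc z)| + 1))).
  rewrite ler_wpM2r ?addr_ge0// ge0_ler_powR// ?nnegrE ?normc_ge0//; first lra.
  by rewrite mulr_ge0// ltW.
rewrite /Halpha !powRM// ?(ltW z0) ?(ltW e0)// -!mulrA.
by rewrite ler_wpM2l ?powR_ge0// powR_ln_homo.
Qed.

(** A supremum in [R] dominates its set only when that set is bounded above;
    here the bound comes from the values of the logarithm at the endpoints. *)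
Lemma le_Upsilon e L y : 0 < e -> e <= y -> y <= L ->
  `|ln y| + 1 <= Upsilon e L.
Proof.
move=> e0 ey yL; apply: ub_le_sup; last first.
  by exists y => //=; rewrite in_itv/= ey.
exists (`|ln e| + `|ln L| + 1) => _ /= [t + <-]; rewrite in_itv/= => /andP[et tL].
have t0 : 0 < t by exact: lt_le_trans et.
have : ln e <= ln t by rewrite ler_ln ?posrE.
have : ln t <= ln L by rewrite ler_ln ?posrE// (lt_le_trans t0).
have := ler_norm (ln L); have := ler_norm (- ln e); rewrite normrN => h1 h2 h3 h4.
have := normr_ge0 (ln L); have := normr_ge0 (ln e) => h5 h6.
by rewrite lerD2r ler_norml; apply/andP; split; lra.
Qed.

Lemma normc_flogB_sq a e L z w : 0 < a < 1 -> 0 < e -> e <= delta_alpha a ->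
  normc z <= L -> normc w <= L ->
  normc (flog z - flog w) ^+ 2 <=
  Halpha a e ^+ 2 * normc (z - w) `^ (2 * a) +
  Upsilon e L ^+ 2 * normc (z - w) ^+ 2.
Proof.
move=> a01 e0 ed; wlog wz : z w / normc w <= normc z.
  move=> H zL wL; have [|/ltW] := leP (normc w) (normc z); first by move/H; exact.
  by move=> /H; rewrite normcBC (normcBC z w); exact.
move=> zL wL; have [ze|/ltW ez] := leP (normc z) e.
  apply: (@le_trans _ _ ((Halpha a e * normc (z - w) `^ a) ^+ 2)).
    by rewrite lerXn2r ?nnegrE ?normc_ge0 ?mulr_ge0 ?Halpha_ge0 ?powR_ge0//
      normc_flogB_small// (le_trans wz).
  have -> : normc (z - w) `^ (2 * a) = (normc (z - w) `^ a) ^+ 2.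
    by rewrite -powR_mulrn ?powR_ge0// -powRrM mulrC.
  by rewrite exprMn lerDl mulr_ge0// sqr_ge0.
apply: (@le_trans _ _ ((Upsilon e L * normc (z - w)) ^+ 2)).
  have Uz := le_Upsilon e0 ez zL.
  have U0 : 0 <= Upsilon e L by apply: le_trans Uz; rewrite addr_ge0.
  rewrite lerXn2r ?nnegrE ?normc_ge0 ?mulr_ge0 ?normc_ge0//.
  by apply: le_trans (normc_flogB wz) _; rewrite mulrC ler_wpM2r ?normc_ge0.
by rewrite exprMn lerDr mulr_ge0 ?sqr_ge0 ?powR_ge0.
Qed.

End Pointwise.

(** * Norms as integrals, and measurability *)

Section Integration.
Variables (R : realType) (d : nat) (Omega : set 'rV[R]_d).
Hypothesis mOmega : measurable (Omega : set (Rd R d)).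
Implicit Types (w u v : 'rV[R]_d -> R[i]) (p L a e : R).

(** The norm is an integral over the whole space of an extension by 0; as
    0 to the power [p] is 0, the extension can be traded for the domain [Omega]. *)
Lemma LpNorm_powR p w : 0 < p ->
  (LpNorm Omega p%:E w `^ p =
   \int[@lebesgue R d]_(x in Omega) (normc (w x) `^ p)%:E)%E.
Proof.
move=> p0; rewrite /LpNorm poweR_Lnorm ?gt_eqF// [RHS]integral_mkcond.
apply: eq_integral => x _; rewrite /patch; case: ifPn => _.
  by rewrite gee0_abs ?lee_fin ?normc_ge0.
by rewrite abse0 poweR0r ?gt_eqF.
Qed.

Lemma LpNorm2_sqr w :
  (LpNorm Omega 2%:E w ^+ 2 =
   \int[@lebesgue R d]_(x in Omega) (normc (w x) ^+ 2)%:E)%E.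
Proof.
have -> : (LpNorm Omega 2%:E w ^+ 2 = LpNorm Omega 2%:E w `^ 2)%E.
  have : (0 <= LpNorm Omega 2%:E w)%E by exact: Lnorm_ge0.
  case: (LpNorm _ _ _) => [r|_|//]; last by rewrite poweRyr// expe2.
  by rewrite lee_fin => r0; rewrite poweR_EFin powR_mulrn// EFin_expe.
rewrite LpNorm_powR//; apply: eq_integral => x _.
by rewrite powR_mulrn ?normc_ge0.
Qed.

(** The norm is an essential supremum, except on a space of measure zero, where
    it is set to 0 and every property holds almost everywhere. *)
Lemma ae_normc_le_LpNorm w L : (LpNorm Omega +oo w <= L%:E)%E ->
  {ae @lebesgue R d, forall x : Rd R d, Omega x -> normc (w x) <= L}.
Proof.
rewrite /LpNorm unlock; case: ifPn => [_ /ess_sup_inf.ess_supP|mu0 _].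
  apply: filterS => x /= + Ox.
  by rewrite /patch mem_set//= lee_fin ger0_norm ?normc_ge0.
by apply: measure0_ae; apply/eqP; rewrite eq_le measure_ge0 andbT leNgt.
Qed.

Definition measurable_ReIm w :=
  measurable_fun (Omega : set (Rd R d)) (fun x : Rd R d => complex.Re (w x)) /\
  measurable_fun (Omega : set (Rd R d)) (fun x : Rd R d => complex.Im (w x)).

Lemma measurable_normc w : measurable_ReIm w ->
  measurable_fun (Omega : set (Rd R d)) (fun x : Rd R d => normc (w x)).
Proof.
move=> [mr mi]; have -> : (fun x : Rd R d => normc (w x)) = @Num.sqrt R \o
    (fun x => complex.Re (w x) ^+ 2 + complex.Im (w x) ^+ 2).
  by apply/funext => x /=; case: (w x).
apply: measurableT_comp; first by apply: continuous_measurable_fun; exact: sqrt_continuous.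
by apply: measurable_funD; exact: measurable_funX.
Qed.

Lemma measurable_ReIm_sub u v : measurable_ReIm u -> measurable_ReIm v ->
  measurable_ReIm (fun x => u x - v x).
Proof.
move=> [ur ui] [vr vi]; split.
  rewrite (_ : (fun x => _) = (fun x => complex.Re (u x) - complex.Re (v x))).
    exact: measurable_funB.
  by apply/funext => x; rewrite raddfB.
rewrite (_ : (fun x => _) = (fun x => complex.Im (u x) - complex.Im (v x))).
  exact: measurable_funB.
by apply/funext => x; rewrite raddfB.
Qed.

Lemma measurable_ReIm_flog u : measurable_ReIm u -> measurable_ReIm (fun x => flog (u x)).
Proof.
move=> mu; have ml := measurableT_comp (@measurable_ln R) (measurable_normc mu).
case: mu => ur ui; split.
  rewrite (_ : (fun x => _) = (fun x => complex.Re (u x) * ln (normc (u x)))).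
    exact: measurable_funM.
  by apply/funext => x; rewrite flogE; case: (u x) => a b /=; ring.
rewrite (_ : (fun x => _) = (fun x => complex.Im (u x) * ln (normc (u x)))).
  exact: measurable_funM.
by apply/funext => x; rewrite flogE; case: (u x) => a b /=; ring.
Qed.

End Integration.

(** * Integrated estimates *)

Section Estimates.
Variables (R : realType) (d : nat) (Omega : set 'rV[R]_d).
Hypothesis mOmega : measurable (Omega : set (Rd R d)).
Variables (u v : 'rV[R]_d -> R[i]).
Hypotheses (hu : Linfty Omega u) (hv : Linfty Omega v).

(** [Lambda_infty] is defined through [fine], which sends +oo to 0: it bounds
    both functions because their norms are finite. *)
Lemma ae_normc_le_Lambda :
  {ae @lebesgue R d, forall x : Rd R d, Omega x ->
    normc (u x) <= Lambda_infty Omega u v /\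
    normc (v x) <= Lambda_infty Omega u v}.
Proof.
case: hu hv => _ _ uoo [_ _ voo].
have fu : LpNorm Omega +oo u \is a fin_num by rewrite ge0_fin_numE// Lnorm_ge0.
have fv : LpNorm Omega +oo v \is a fin_num by rewrite ge0_fin_numE// Lnorm_ge0.
have LE : (Lambda_infty Omega u v)%:E =
    Order.max (LpNorm Omega +oo u) (LpNorm Omega +oo v).
  by rewrite fineK// maxEle; case: ifP.
have uL : (LpNorm Omega +oo u <= (Lambda_infty Omega u v)%:E)%E.
  by rewrite LE le_max lexx.
have vL : (LpNorm Omega +oo v <= (Lambda_infty Omega u v)%:E)%E.
  by rewrite LE le_max lexx orbT.
apply: filterS2 (ae_normc_le_LpNorm uL) (ae_normc_le_LpNorm vL) => x ux vx Ox.
by split; [exact: ux|exact: vx].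
Qed.

Let D x := u x - v x.
Let F x := flog (u x) - flog (v x).

Let mReIm_u : measurable_ReIm Omega u. Proof. by case: hu. Qed.
Let mReIm_v : measurable_ReIm Omega v. Proof. by case: hv. Qed.

Let mD : measurable_fun (Omega : set (Rd R d)) (fun x : Rd R d => normc (D x)).
Proof. exact: measurable_normc (measurable_ReIm_sub mReIm_u mReIm_v). Qed.

Let mF : measurable_fun (Omega : set (Rd R d)) (fun x : Rd R d => normc (F x)).
Proof.
apply: measurable_normc; apply: measurable_ReIm_sub; exact: measurable_ReIm_flog.
Qed.

Lemma LpNorm_flogB_sq a e : 0 < a < 1 -> 0 < e -> e <= delta_alpha a ->
  (LpNorm Omega 2%:E F ^+ 2 <=
     (Halpha a e ^+ 2)%:E * LpNorm Omega (2 * a)%:E D `^ (2 * a) +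
     (Upsilon e (Lambda_infty Omega u v) ^+ 2)%:E * LpNorm Omega 2%:E D ^+ 2)%E.
Proof.
move=> a01 e0 ed; case/andP: (a01) => a0 a1.
rewrite !LpNorm2_sqr LpNorm_powR ?mulr_gt0//.
have m2 : measurable_fun (Omega : set (Rd R d)) (fun x => (normc (D x) ^+ 2)%:E).
  exact/measurable_EFinP/measurable_funX.
have m2a : measurable_fun (Omega : set (Rd R d))
    (fun x => (normc (D x) `^ (2 * a))%:E).
  by apply/measurable_EFinP; exact: measurableT_comp (measurable_powR _) mD.
rewrite -ge0_integralZl_EFin// ?sqr_ge0//; last first.
  by move=> x _; rewrite lee_fin powR_ge0.
rewrite -ge0_integralZl_EFin// ?sqr_ge0//; last first.
  by move=> x _; rewrite lee_fin sqr_ge0.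
rewrite -ge0_integralD//; first last.
- exact: measurable_funeM.
- by move=> x _; rewrite -EFinM lee_fin mulr_ge0 ?sqr_ge0.
- exact: measurable_funeM.
- by move=> x _; rewrite -EFinM lee_fin mulr_ge0 ?sqr_ge0 ?powR_ge0.
apply: ae_ge0_le_integral => //.
- by move=> x _; rewrite lee_fin sqr_ge0.
- exact/measurable_EFinP/measurable_funX.
- by move=> x _; rewrite -!EFinM -EFinD lee_fin addr_ge0// mulr_ge0 ?sqr_ge0 ?powR_ge0.
- by apply: emeasurable_funD; apply: measurable_funeM.
apply: filterS ae_normc_le_Lambda => x /= uv Ox; case: (uv Ox) => ux vx.
by rewrite -!EFinM -EFinD lee_fin normc_flogB_sq.
Qed.

(** The squared inequality is integrated first; taking square roots afterwards
    turns the exponent 2 alpha of the quasi-norm into alpha. *)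
Lemma LpNorm_flogB_small a e : 0 < a < 1 -> e <= delta_alpha a ->
  Lambda_infty Omega u v <= e ->
  (LpNorm Omega 2%:E F <=
     (Halpha a e)%:E * LpNorm Omega (2 * a)%:E D `^ a)%E.
Proof.
move=> a01 ed Le; case/andP: (a01) => a0 a1.
have m2a : measurable_fun (Omega : set (Rd R d))
    (fun x => (normc (D x) `^ (2 * a))%:E).
  by apply/measurable_EFinP; exact: measurableT_comp (measurable_powR _) mD.
have sq : (LpNorm Omega 2%:E F `^ 2 <=
    (Halpha a e `^ 2)%:E * LpNorm Omega (2 * a)%:E D `^ (2 * a))%E.
  rewrite !LpNorm_powR ?mulr_gt0// -ge0_integralZl_EFin ?powR_ge0//; last first.
    by move=> x _; rewrite lee_fin powR_ge0.
  apply: ae_ge0_le_integral => //.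
  - by move=> x _; rewrite lee_fin powR_ge0.
  - by apply/measurable_EFinP; exact: measurableT_comp (measurable_powR _) mF.
  - by move=> x _; rewrite -EFinM lee_fin mulr_ge0 ?powR_ge0.
  - exact: measurable_funeM.
  apply: filterS ae_normc_le_Lambda => x /= uv Ox; case: (uv Ox) => ux vx.
  rewrite -EFinM lee_fin [2 * a]mulrC powRrM -powRM ?Halpha_ge0 ?powR_ge0//.
  rewrite ge0_ler_powR ?nnegrE ?normc_ge0 ?mulr_ge0 ?Halpha_ge0 ?powR_ge0//.
  by apply: normc_flogB_small => //; exact: le_trans Le.
have half (y : \bar R) r : (0 <= y)%E -> ((y `^ (2 * r)) `^ 2^-1 = y `^ r)%E.
  by move=> y0; rewrite -poweRrM mulrAC divff// mul1r.
have F0 : (0 <= LpNorm Omega 2%:E F)%E by exact: Lnorm_ge0.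
have D0 : (0 <= LpNorm Omega (2 * a)%:E D)%E by exact: Lnorm_ge0.
rewrite -(half _ a)// -[leLHS]poweRe1// -(half _ 1)// mulr1.
have -> : (Halpha a e)%:E = ((Halpha a e `^ 2)%:E `^ 2^-1)%E.
  by rewrite poweR_EFin -powRrM divff// powRr1 ?Halpha_ge0.
rewrite -poweRM ?poweR_ge0 ?lee_fin ?powR_ge0//.
apply: gt0_ler_poweR => //; rewrite in_itv/= leey andbT ?poweR_ge0//.
by rewrite mule_ge0 ?poweR_ge0 ?lee_fin ?powR_ge0.
Qed.

End Estimates.

Theorem theorem2p1 (R : realType) (d : nat) (Omega : set 'rV[R]_d)
    (u v : 'rV[R]_d -> R[i]) (alpha epsilon : R)
    (hd : (1 <= d <= 3)%N)
    (hOmega : bounded_domain Omega)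
    (hu : Linfty Omega u) (hv : Linfty Omega v)
    (halpha : 0 < alpha < 1)
    (hepsilon : 0 < epsilon <= delta_alpha alpha) :
  (epsilon < Lambda_infty Omega u v ->
    (LpNorm Omega 2%:E (fun x => flog (u x) - flog (v x))%R ^+ 2 <=
     (Halpha alpha epsilon ^+ 2)%:E *
       LpNorm Omega (2 * alpha)%R%:E (fun x => u x - v x)%R `^ (2 * alpha)%R +
     (Upsilon epsilon (Lambda_infty Omega u v) ^+ 2)%:E *
       LpNorm Omega 2%:E (fun x => u x - v x)%R ^+ 2)%E) /\
  (Lambda_infty Omega u v <= epsilon ->
    (LpNorm Omega 2%:E (fun x => flog (u x) - flog (v x))%R <=
     (Halpha alpha epsilon)%:E *
       LpNorm Omega (2 * alpha)%R%:E (fun x => u x - v x)%R `^ alpha)%E).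
Proof.
have [_ oOmega _ _] := hOmega; have mOmega := open_measurable_Rd oOmega.
have /andP[e0 ed] := hepsilon; split=> [_|Le].
  exact: LpNorm_flogB_sq.
exact: LpNorm_flogB_small.
Qed.
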